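(* Let $\mathcal M$ be an infinite subset of $\mathbb R$ and $0<p\le 1$. If the closure of $\mathcal M$ has (Lebesgue) measure zero then $\mathcal F_p(\mathcal M,|\cdot|^{1/p})$ is isometrically isomorphic to $\ell_p$. In particular, the result holds if $\mathcal M$ is the (infinite) range of a monotone sequence of real numbers.
   Context: All vector spaces are real. $(\mathcal M,|\cdot|^{1/p})$ denotes $\mathcal M$ with the $p$-metric $\rho(x,y)=|x-y|^{1/p}$ and any point of $\mathcal M$ as base point (the choice of base point does not affect $\mathcal F_p$ up to isometric isomorphism). For $0<p\le 1$, a $p$-metric on a set $\mathcal{M}$ is a symmetric map $\rho\colon\mathcal M\times\mathcal M\to[0,\infty)$ with $\rho(x,y)=0$ iff $x=y$ and $\rho(x,y)^p\le\rho(x,z)^p+\rho(z,y)^p$ for all $x,y,z$. A $p$-norm on a vector space $Y$ is a map $\|\cdot\|_Y\colon Y\to[0,\infty)$, vanishing only at $0$, with $\|\alpha y\|_Y=|\alpha|\|y\|_Y$ and $\|y+z\|_Y^p\le\|y\|_Y^p+\|z\|_Y^p$. A map $f\colon\mathcal M\to Y$ is $1$-Lipschitz if $\|f(x)-f(y)\|_Y\le\rho(x,y)$ for all $x,y$. Let $(\mathcal M,\rho)$ be a pointed $p$-metric space, let $\mathbb R_0^{\mathcal M}$ be the space of all functions $f\colon\mathcal M\to\mathbb R$ vanishing at the base point, let $\delta(x)$ be the linear functional on $\mathbb R_0^{\mathcal M}$ given by $\langle\delta(x),f\rangle=f(x)$, and let $\mathcal P(\mathcal M)$ be the linear span of $\{\delta(x)\colon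 x\in\mathcal M\}$. For $\mu=\sum_{j=1}^N a_j\delta(x_j)$ put $$\|\mu\|_{\mathcal F_p(\mathcal M)}=\sup\Big\|\sum_{j=1}^N a_jf(x_j)\Big\|_Y,$$ the supremum being over all $p$-normed spaces $Y$ and all $1$-Lipschitz maps $f\colon\mathcal M\to Y$ sending the base point to $0$. This is a $p$-norm on $\mathcal P(\mathcal M)$, and the Lipschitz free $p$-space $\mathcal F_p(\mathcal M)$ is the completion of $\mathcal P(\mathcal M)$ with respect to it. *)

(* Defs.v *)
From HB Require Import structures.
From mathcomp Require Import all_boot all_order all_algebra.
From mathcomp Require Import all_classical all_reals all_analysis.
Import Order.TTheory GRing.Theory Num.Theory.
Import numFieldNormedType.Exports.

Set Implicit Arguments.
Unset Strict Implicit.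
Unset Printing Implicit Defensive.

Local Open Scope classical_set_scope.
Local Open Scope ring_scope.

Section powR_facts.
Variable R : realType.
Implicit Types (p r a b x y : R).

Lemma powRK r x : 0 < r -> 0 <= x -> (x `^ r) `^ r^-1 = x.
Proof. by move=> r0 x0; rewrite -powRrM mulfV ?gt_eqF// powRr1. Qed.

Lemma powRVK r x : 0 < r -> 0 <= x -> (x `^ r^-1) `^ r = x.
Proof. by move=> r0 x0; rewrite -powRrM mulVf ?gt_eqF// powRr1. Qed.

Lemma ler_powR2 r x y : 0 < r -> 0 <= x -> 0 <= y -> (x `^ r <= y `^ r) = (x <= y).
Proof.
move=> r0 x0 y0; apply/idP/idP => [|xy]; last first.
  by apply: ge0_ler_powR => //; exact: ltW.
by apply: contraTT; rewrite -!ltNge => yx; apply: gt0_ltr_powR.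
Qed.

Lemma ltr_powR2 r x y : 0 < r -> 0 <= x -> 0 <= y -> (x `^ r < y `^ r) = (x < y).
Proof. by move=> r0 x0 y0; rewrite !ltNge ler_powR2. Qed.

Lemma powR_subadditive p x y : 0 < p <= 1 -> 0 <= x -> 0 <= y ->
  (x + y) `^ p <= x `^ p + y `^ p.
Proof.
move=> /andP[p0 p1] x0 y0.
have [->|xy0] := eqVneq (x + y) 0.
  by rewrite powR0 ?gt_eqF// addr_ge0 ?powR_ge0.
have s0 : 0 < x + y by rewrite lt_neqAle eq_sym xy0 addr_ge0.
have aux z : 0 <= z -> z <= x + y -> (z / (x + y)) * (x + y) `^ p <= z `^ p.
  move=> z0 zs; have [->|zn0] := eqVneq z 0; first by rewrite !mul0r powR_ge0.
  have z0' : 0 < z by rewrite lt_neqAle eq_sym zn0.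
  rewrite [leRHS](_ : _ = (z / (x + y)) `^ p * (x + y) `^ p); last first.
    by rewrite -powRM ?divr_ge0 ?(ltW s0)// divfK.
  apply: ler_wpM2r; first exact: powR_ge0.
  by apply: ger1_powR => //; rewrite divr_gt0//= ler_pdivrMr// mul1r.
apply: le_trans (lerD (aux x x0 _) (aux y y0 _)); rewrite ?lerDl ?lerDr//.
by rewrite -mulrDl -mulrDl mulfV// mul1r.
Qed.

Lemma cvg_powR r (v : R^nat) (l : R) : 0 < r -> (forall n, 0 <= v n) ->
  v @ \oo --> l -> (fun n => v n `^ r) @ \oo --> l `^ r.
Proof.
move=> r0 v0 vl.
have l0 : 0 <= l.
  have -> : l = limn v by apply/esym/cvg_lim.
  by apply: limr_ge; [exact: cvgP vl | exact: nearW].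
have [l_eq0|ln0] := eqVneq l 0; last first.
  have lgt0 : 0 < l by rewrite lt_neqAle eq_sym ln0.
  apply: (@cvg_comp _ _ _ v (fun x => x `^ r) _ _ _ vl).
  have : derivable (fun x : R => x `^ r) l 1.
    by apply: derivable_powR; rewrite in_itv/= lgt0.
  by move/derivable1_diffP/differentiable_continuous.
rewrite l_eq0 powR0 ?gt_eqF//; rewrite l_eq0 in vl.
apply/cvgrPdist_lt => e e0.
move/cvgrPdist_lt : vl => /(_ (e `^ r^-1)); rewrite powR_gt0// => /(_ isT).
apply: filterS => n; rewrite !sub0r !normrN (ger0_norm (v0 n)).
rewrite (ger0_norm (powR_ge0 _ _)) => vne.
by rewrite -[e](powRVK r0 (ltW e0)) ltr_powR2// powR_ge0.
Qed.

End powR_facts.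

Section structures.
Variables (R : realType) (p : R).

Record pSeminormedSpace := PSeminormedSpace {
  pn_sort :> lmodType R;
  pnorm : pn_sort -> R;
  pn_exponent : 0 < p <= 1;
  pnorm_ge0 : forall x, 0 <= pnorm x;
  pnormZ : forall (a : R) x, pnorm (a *: x) = `|a| * pnorm x;
  pnormD : forall x y, pnorm (x + y) `^ p <= pnorm x `^ p + pnorm y `^ p }.

Record pNormedSpace := PNormedSpace {
  pn_seminormed :> pSeminormedSpace;
  pnorm0_eq0 : forall x : pn_seminormed, pnorm x = 0 -> x = 0 }.

Record pointedPMetricSpace := PointedPMetricSpace {
  pm_sort :> Type;
  pdist : pm_sort -> pm_sort -> R;
  pm_base : pm_sort;
  pm_exponent : 0 < p <= 1;
  pdist_ge0 : forall x y, 0 <= pdist x y;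
  pdist_eq0 : forall x y, pdist x y = 0 <-> x = y;
  pdistC : forall x y, pdist x y = pdist y x;
  pdist_triangle : forall x y z,
    pdist x y `^ p <= pdist x z `^ p + pdist z y `^ p }.

Definition isometrically_isomorphic (X Y : pNormedSpace) :=
  exists T : {linear X -> Y},
    bijective T /\ (forall x, pnorm (T x) = pnorm x).

Definition lipschitz1 (M : pointedPMetricSpace) (Y : pNormedSpace)
    (f : M -> Y) :=
  forall x y, pnorm (f x - f y) <= pdist x y.

End structures.

Section pseminorm_theory.
Variables (R : realType) (p : R) (X : pSeminormedSpace p).
Implicit Types x y : X.

Lemma pn_gt0 : 0 < p. Proof. by case/andP: (pn_exponent X). Qed.

Lemma pnorm0 : pnorm (0 : X) = 0.
Proof. by rewrite -(scale0r (0 : X)) pnormZ normr0 mul0r. Qed.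

Lemma pnormN x : pnorm (- x) = pnorm x.
Proof. by rewrite -scaleN1r pnormZ normrN1 mul1r. Qed.

Lemma pnormB x y : pnorm (x - y) `^ p <= pnorm x `^ p + pnorm y `^ p.
Proof. by rewrite -(pnormN y) pnormD. Qed.

Lemma pdistrC x y : pnorm (x - y) = pnorm (y - x).
Proof. by rewrite -pnormN opprB. Qed.

Lemma ler_pdist x y :
  `|pnorm x `^ p - pnorm y `^ p| <= pnorm (x - y) `^ p.
Proof.
rewrite ler_norml lerBlDl lerBrDl; apply/andP; split.
  by rewrite lerBlDr pdistrC addrC -{1}(subrK x y) pnormD.
by rewrite addrC -{1}(subrK y x) pnormD.
Qed.

Lemma ler_pnorm_sum I (s : seq I) (F : I -> X) :
  pnorm (\sum_(i <- s) F i) `^ p <= \sum_(i <- s) pnorm (F i) `^ p.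
Proof.
elim: s => [|i s IH]; first by rewrite !big_nil pnorm0 powR0// gt_eqF// pn_gt0.
by rewrite !big_cons; apply: le_trans (pnormD _ _) _; rewrite lerD2l.
Qed.

Lemma pnorm_cvg0 (u : nat -> X) :
  (fun n => pnorm (u n)) @ \oo --> 0 <-> (fun n => pnorm (u n) `^ p) @ \oo --> 0.
Proof.
have p0 := pn_gt0; split=> u0.
  rewrite -(@powR0 R p) ?gt_eqF//; apply: cvg_powR => // n; exact: pnorm_ge0.
have -> : (fun n => pnorm (u n)) = (fun n => (pnorm (u n) `^ p) `^ p^-1).
  by apply/funext => n; rewrite powRK// pnorm_ge0.
rewrite -(@powR0 R p^-1) ?gt_eqF ?invr_gt0//; apply: cvg_powR => //.
  by rewrite invr_gt0.
by move=> n; exact: powR_ge0.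
Qed.

End pseminorm_theory.

Section completion.
Variables (R : realType) (p : R) (X : pSeminormedSpace p).

(* The completion is the space of Cauchy sequences modulo the sequences whose
   p-seminorm tends to 0, normed by the limit of the p-seminorms. *)
Definition cauchy_pred : {pred nat -> X} := fun u =>
  `[< forall e : R, 0 < e -> exists N : nat, forall m n : nat,
        (N <= m)%N -> (N <= n)%N -> pnorm (u m - u n) < e >].

Lemma cauchy_predP (u : nat -> X) :
  (forall e : R, 0 < e -> exists N : nat, forall m n : nat,
        (N <= m)%N -> (N <= n)%N -> pnorm (u m - u n) `^ p < e) <->
  u \in cauchy_pred.
Proof.
have p0 := pn_gt0 X; rewrite unfold_in; split.
  move=> h; apply/asboolP => e e0.
  have [|N hN] := h (e `^ p); first by rewrite powR_gt0.
  exists N => m n Nm Nn; rewrite -(@ltr_powR2 _ p) ?pnorm_ge0 ?(ltW e0)//.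
  exact: hN.
move/asboolP => h e e0.
have [|N hN] := h (e `^ p^-1); first by rewrite powR_gt0.
exists N => m n Nm Nn; rewrite -(powRVK p0 (ltW e0)) ltr_powR2 ?pnorm_ge0//.
  exact: hN.
exact: powR_ge0.
Qed.

Lemma cauchy_submod_closed : submod_closed cauchy_pred.
Proof.
have p0 := pn_gt0 X; split.
  apply/cauchy_predP => e e0; exists 0%N => m n _ _.
  by rewrite subrr pnorm0 powR0// gt_eqF.
move=> a u v /cauchy_predP cu /cauchy_predP cv; apply/cauchy_predP => e e0.
have e2 : 0 < e / 2 by rewrite divr_gt0.
have a1 : 0 < `|a| `^ p + 1 by rewrite ltr_wpDl// powR_ge0.
have [N1 h1] := cu _ (divr_gt0 e2 a1); have [N2 h2] := cv _ e2.
exists (maxn N1 N2) => m n; rewrite !geq_max => /andP[m1 m2] /andP[n1 n2].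
have -> : (a *: u + v) m - (a *: u + v) n =
    a *: (u m - u n) + (v m - v n) by rewrite scalerBr opprD addrACA.
apply: le_lt_trans (pnormD _ _) _; rewrite [ltRHS](splitr e).
apply: ltr_leD; last by apply: ltW; exact: h2.
rewrite pnormZ powRM ?pnorm_ge0//.
have := h1 _ _ m1 n1; rewrite ltr_pdivlMr// mulrC; apply: le_lt_trans.
by rewrite ler_wpM2r ?powR_ge0// lerDl.
Qed.

HB.instance Definition _ := GRing.isSubmodClosed.Build R (nat -> X) cauchy_pred
  cauchy_submod_closed.

Record cauchySeq := CauchySeq {
  cauchy_val :> nat -> X;
  _ : cauchy_val \in cauchy_pred }.

HB.instance Definition _ := [isSub for cauchy_val].
HB.instance Definition _ := [Choice of cauchySeq by <:].
HB.instance Definition _ := [SubChoice_isSubLmodule of cauchySeq by <:].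

Lemma cauchyP (u : cauchySeq) (e : R) : 0 < e -> exists N : nat, forall m n : nat,
  (N <= m)%N -> (N <= n)%N -> pnorm (u m - u n) `^ p < e.
Proof. by move: e; apply/cauchy_predP; exact: valP. Qed.

Definition null_pred : {pred cauchySeq} := fun u =>
  `[< (fun n => pnorm (u n)) @ \oo --> 0 >].

Lemma null_predP (u : cauchySeq) :
  reflect ((fun n => pnorm (u n) `^ p) @ \oo --> 0) (u \in null_pred).
Proof. by apply: (iffP (asboolP _)) => /pnorm_cvg0. Qed.

Lemma null_submod_closed : submod_closed null_pred.
Proof.
have p0 := pn_gt0 X; split.
  apply/asboolP; rewrite [X in X @ _](_ : _ = cst 0); first exact: cvg_cst.
  by apply/funext => n; rewrite /= pnorm0.
move=> a u v /null_predP u0 /null_predP v0; apply/null_predP.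
apply: (@squeeze_cvgr _ _ _ _ (cst 0)
  (fun n => `|a| `^ p * pnorm (u n) `^ p + pnorm (v n) `^ p)).
- apply: nearW => n; rewrite powR_ge0/= -powRM ?pnorm_ge0// -pnormZ.
  exact: pnormD.
- exact: cvg_cst.
- have -> : (0 : R) = `|a| `^ p * 0 + 0 by rewrite mulr0 addr0.
  by apply: cvgD => //; apply: cvgM => //; exact: cvg_cst.
Qed.

HB.instance Definition _ := GRing.isSubmodClosed.Build R cauchySeq null_pred
  null_submod_closed.

Definition completion_sort := Quotient.quot null_pred.

HB.instance Definition _ := GRing.Zmodule.on completion_sort.
HB.instance Definition _ := EqQuotient.on completion_sort.

Definition completion_pi (u : cauchySeq) : completion_sort := (\pi u)%qT.

Lemma completion_ind (P : completion_sort -> Prop) :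
  (forall u, P (completion_pi u)) -> forall x, P x.
Proof. by move=> h x; rewrite -[x]reprK; exact: h. Qed.

Lemma completion_eqP (u v : cauchySeq) :
  completion_pi u = completion_pi v <->
  (fun n => pnorm (u n - v n)) @ \oo --> 0.
Proof.
split=> [/eqP|h]; first by rewrite -Quotient.idealrBE => /asboolP.
by apply/eqP; rewrite -Quotient.idealrBE; exact/asboolP.
Qed.

Lemma completion_piD u v :
  completion_pi (u + v) = completion_pi u + completion_pi v.
Proof. exact: raddfD. Qed.

Lemma completion_repr (u : cauchySeq) :
  completion_pi (repr (completion_pi u)) = completion_pi u.
Proof. exact: reprK. Qed.

Definition completion_scale (a : R) (x : completion_sort) : completion_sort :=
  completion_pi (a *: repr x).

Lemma completion_scaleE a u :
  completion_scale a (completion_pi u) = completion_pi (a *: u).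
Proof.
apply/completion_eqP.
have /completion_eqP := completion_repr u; set v := repr _ => uv.
have -> : (fun n => pnorm ((a *: v) n - (a *: u) n)) =
          (fun n => `|a| * pnorm (v n - u n)).
  by apply/funext => n; rewrite -pnormZ scalerBr.
have -> : (0 : R) = `|a| * 0 by rewrite mulr0.
by apply: cvgM => //; exact: cvg_cst.
Qed.

Fact completion_scaleA a b x :
  completion_scale a (completion_scale b x) = completion_scale (a * b) x.
Proof. by elim/completion_ind: x => u; rewrite !completion_scaleE scalerA. Qed.

Fact completion_scale1 : left_id 1 completion_scale.
Proof. by elim/completion_ind => u; rewrite completion_scaleE scale1r. Qed.

Fact completion_scaleDr : right_distributive completion_scale +%R.
Proof.
move=> a; elim/completion_ind => u; elim/completion_ind => v.
by rewrite -completion_piD !completion_scaleE -completion_piD scalerDr.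
Qed.

Fact completion_scaleDl x :
  {morph completion_scale^~ x : a b / a + b}.
Proof.
move=> a b; elim/completion_ind: x => u.
by rewrite !completion_scaleE -completion_piD scalerDl.
Qed.

HB.instance Definition _ := GRing.Zmodule_isLmodule.Build R completion_sort
  completion_scaleA completion_scale1 completion_scaleDr completion_scaleDl.

Lemma completion_piZ a u :
  completion_pi (a *: u) = a *: completion_pi u.
Proof. by rewrite -completion_scaleE. Qed.

Definition cauchy_norm (u : cauchySeq) : R := limn (fun n => pnorm (u n)).

Definition completion_norm (x : completion_sort) : R := cauchy_norm (repr x).

Lemma is_cvg_cauchy_norm (u : cauchySeq) : cvgn (fun n => pnorm (u n)).
Proof.
have p0 := pn_gt0 X.
have /cvg_ex[l hl] : cvgn (fun n => pnorm (u n) `^ p).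
  apply/cauchy_cvgP/cauchy_exP => e e0; have [N hN] := cauchyP u e0.
  exists (pnorm (u N) `^ p); exists N => // n /= Nn.
  by apply: le_lt_trans (ler_pdist _ _) _; exact: hN.
have -> : (fun n => pnorm (u n)) = (fun n => (pnorm (u n) `^ p) `^ p^-1).
  by apply/funext => n; rewrite powRK// pnorm_ge0.
apply/cvg_ex; exists (l `^ p^-1); apply: (cvg_powR _ _ hl).
  by rewrite invr_gt0.
by move=> n; exact: powR_ge0.
Qed.

Lemma cauchy_norm_cvg (u : cauchySeq) :
  (fun n => pnorm (u n)) @ \oo --> cauchy_norm u.
Proof. exact: is_cvg_cauchy_norm. Qed.

Lemma cauchy_norm_powR_cvg (u : cauchySeq) :
  (fun n => pnorm (u n) `^ p) @ \oo --> cauchy_norm u `^ p.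
Proof.
apply: (@cvg_powR R p (fun n => pnorm (u n))).
- exact: pn_gt0 X.
- by move=> n; exact: pnorm_ge0.
- exact: cauchy_norm_cvg.
Qed.

Lemma cauchy_norm_ge0 u : 0 <= cauchy_norm u.
Proof.
apply: limr_ge; first exact: is_cvg_cauchy_norm.
by apply: nearW => n; exact: pnorm_ge0.
Qed.

Lemma completion_normE u : completion_norm (completion_pi u) = cauchy_norm u.
Proof.
have p0 := pn_gt0 X; rewrite /completion_norm.
have /completion_eqP := completion_repr u; set v := repr _ => /pnorm_cvg0 uv.
apply: (powR_injective p0); rewrite ?nnegrE ?cauchy_norm_ge0//.
apply/eqP; rewrite -subr_eq0; apply/eqP.
have h : (fun n => pnorm (v n) `^ p - pnorm (u n) `^ p) @ \oo -->
   cauchy_norm v `^ p - cauchy_norm u `^ p.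
  by apply: cvgB; exact: cauchy_norm_powR_cvg.
apply: (cvg_unique _ h) => //; apply: norm_cvg0.
apply: (@squeeze_cvgr _ _ _ _ (cst 0)
  (fun n => pnorm (v n - u n) `^ p)) => //; last exact: cvg_cst.
by apply: nearW => n /=; rewrite normr_ge0 ler_pdist.
Qed.

Fact completion_norm_ge0 x : 0 <= completion_norm x.
Proof. exact: cauchy_norm_ge0. Qed.

Fact completion_normZ a x : completion_norm (a *: x) = `|a| * completion_norm x.
Proof.
elim/completion_ind: x => u; rewrite -completion_piZ !completion_normE.
rewrite {1}/cauchy_norm; apply/cvg_lim => //.
have -> : (fun n => pnorm ((a *: u) n)) = (fun n => `|a| * pnorm (u n)).
  by apply/funext => n; rewrite -pnormZ.
by apply: cvgM; [exact: cvg_cst | exact: cauchy_norm_cvg].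
Qed.

Fact completion_normD x y : completion_norm (x + y) `^ p <=
  completion_norm x `^ p + completion_norm y `^ p.
Proof.
elim/completion_ind: x => u; elim/completion_ind: y => v.
rewrite -completion_piD !completion_normE.
apply: (ler_cvg_to (@cauchy_norm_powR_cvg (u + v))
  (cvgD (@cauchy_norm_powR_cvg u) (@cauchy_norm_powR_cvg v))).
by apply: nearW => n; exact: pnormD.
Qed.

Fact completion_norm0_eq0 x : completion_norm x = 0 -> x = 0.
Proof.
elim/completion_ind: x => u; rewrite completion_normE => u0.
suff -> : 0 = completion_pi 0.
  apply/completion_eqP; rewrite -u0.
  have -> : (fun n => pnorm (u n - (0 : cauchySeq) n)) = (fun n => pnorm (u n)).
    by apply/funext => n; rewrite subr0.
  exact: cauchy_norm_cvg.
exact/esym/raddf0.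
Qed.

Definition completion : pNormedSpace p :=
  @PNormedSpace R p
    (PSeminormedSpace (pn_exponent X) completion_norm_ge0 completion_normZ
      completion_normD)
    completion_norm0_eq0.

End completion.

Section ell_p.
Variables (R : realType) (p : R) (p01 : 0 < p <= 1).

Let p_gt0 : 0 < p. Proof. by case/andP: p01. Qed.

(* The proof argument is unused: it only makes the closure properties below
   inferable from summable_pred p01. *)
Definition summable_pred of 0 < p <= 1 : {pred nat -> R} := fun u =>
  `[< cvgn (series (fun n => `|u n| `^ p)) >].

Lemma summable_predP (u : R^nat) :
  reflect (cvgn (series (fun n => `|u n| `^ p))) (u \in summable_pred p01).
Proof. exact: asboolP. Qed.

Lemma normr_powRD (a b : R) : `|a + b| `^ p <= `|a| `^ p + `|b| `^ p.
Proof.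
by apply: le_trans (powR_subadditive _ _ _) => //; rewrite ler_powR2// ler_normD.
Qed.

Lemma normr_powRM (a b : R) : `|a * b| `^ p = `|a| `^ p * `|b| `^ p.
Proof. by rewrite normrM powRM. Qed.

Lemma summable_submod_closed : submod_closed (summable_pred p01).
Proof.
split.
  apply/summable_predP.
  have -> : (fun n => `|(0 : R^nat) n| `^ p) = 0.
    by apply/funext => n; rewrite normr0 powR0// gt_eqF.
  have -> : series (0 : R^nat) = 0.
    by apply/funext => n; rewrite /series /= big1.
  exact: is_cvg_cst.
move=> a u v /summable_predP cu /summable_predP cv; apply/summable_predP.
apply: (@series_le_cvg _ _ (fun n => `|a| `^ p * `|u n| `^ p + `|v n| `^ p)).
- by move=> n; exact: powR_ge0.
- by move=> n; rewrite addr_ge0 ?mulr_ge0 ?powR_ge0.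
- by move=> n; rewrite -normr_powRM; exact: normr_powRD.
- have -> : series (fun n => `|a| `^ p * `|u n| `^ p + `|v n| `^ p) =
      `|a| `^ p *: series (fun n => `|u n| `^ p) + series (fun n => `|v n| `^ p).
    by apply/funext => n; rewrite /series /= big_split/= -mulr_sumr.
  by apply: is_cvgD => //; exact: is_cvgZr.
Qed.

HB.instance Definition _ := GRing.isSubmodClosed.Build R (nat -> R)
  (summable_pred p01) summable_submod_closed.

Record ellp_sort := EllpSort {
  ellp_val :> nat -> R;
  _ : ellp_val \in summable_pred p01 }.

HB.instance Definition _ := [isSub for ellp_val].
HB.instance Definition _ := [Choice of ellp_sort by <:].
HB.instance Definition _ := [SubChoice_isSubLmodule of ellp_sort by <:].

Definition ellp_norm (u : ellp_sort) : R :=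
  (limn (series (fun n => `|u n| `^ p))) `^ p^-1.

Lemma ellp_summable (u : ellp_sort) : cvgn (series (fun n => `|u n| `^ p)).
Proof. by apply/summable_predP; exact: valP. Qed.

Lemma ellp_sum_ge0 (u : ellp_sort) : 0 <= limn (series (fun n => `|u n| `^ p)).
Proof.
apply: limr_ge; first exact: ellp_summable.
by apply: nearW => n; apply: sumr_ge0 => i _; exact: powR_ge0.
Qed.

Lemma ellp_normE (u : ellp_sort) :
  ellp_norm u `^ p = limn (series (fun n => `|u n| `^ p)).
Proof. by rewrite powRVK// ellp_sum_ge0. Qed.

Lemma ellp_norm_cvg (u : ellp_sort) :
  series (fun n => `|u n| `^ p) @ \oo --> ellp_norm u `^ p.
Proof. by rewrite ellp_normE; exact: ellp_summable. Qed.

Fact ellp_norm_ge0 u : 0 <= ellp_norm u.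
Proof. exact: powR_ge0. Qed.

Fact ellp_normZ (a : R) u : ellp_norm (a *: u) = `|a| * ellp_norm u.
Proof.
rewrite -[in RHS](powRK p_gt0 (normr_ge0 a)) -powRM ?powR_ge0 ?ellp_sum_ge0//.
congr (_ `^ _).
have -> : series (fun n => `|(a *: u) n| `^ p) =
    `|a| `^ p *: series (fun n => `|u n| `^ p).
  apply/funext => n.
  rewrite -[RHS]/(`|a| `^ p * \sum_(0 <= k < n) `|u k| `^ p) mulr_sumr.
  by apply: eq_bigr => i _; rewrite -normr_powRM.
by rewrite limZr//; exact: ellp_summable.
Qed.

Fact ellp_normD u v :
  ellp_norm (u + v) `^ p <= ellp_norm u `^ p + ellp_norm v `^ p.
Proof.
apply: (ler_cvg_to (@ellp_norm_cvg (u + v))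
  (cvgD (@ellp_norm_cvg u) (@ellp_norm_cvg v))).
apply: nearW => n.
rewrite -[leRHS]/(\sum_(0 <= k < n) `|u k| `^ p + \sum_(0 <= k < n) `|v k| `^ p).
by rewrite -big_split/=; apply: ler_sum => i _; exact: normr_powRD.
Qed.

Fact ellp_norm0_eq0 u : ellp_norm u = 0 -> u = 0.
Proof.
move=> u0; apply/val_inj/funext => n /=.
suff : `|u n| `^ p <= 0.
  by move=> h; apply/normr0_eq0/(@powR_eq0_eq0 _ _ p)/le_anti; rewrite h powR_ge0.
have <- : limn (series (fun n => `|u n| `^ p)) = 0.
  by rewrite -ellp_normE u0 powR0// gt_eqF.
have nd : nondecreasing_seq (series (fun n => `|u n| `^ p)).
  by apply: nondecreasing_series => i _ _; exact: powR_ge0.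
apply: le_trans (nondecreasing_cvgn_le nd (@ellp_summable u) n.+1).
rewrite seriesSr lerDr.
by apply: sumr_ge0 => i _; exact: powR_ge0.
Qed.

Definition ellp : pNormedSpace p :=
  @PNormedSpace R p
    (PSeminormedSpace p01 ellp_norm_ge0 ellp_normZ ellp_normD) ellp_norm0_eq0.

End ell_p.

Section free_space.
Variables (R : realType) (p : R) (M : pointedPMetricSpace p).

Definition based_fun := {f : M -> R | f (pm_base M) = 0}.

Definition delta (x : M) : based_fun -> R := fun f => sval f x.

(* A list s of pairs (a_j, x_j) encodes the formal combination of the x_j with
   weights a_j, and lincomb f s is the sum of the a_j f(x_j). *)
Definition lincomb (V : lmodType R) (f : M -> V) (s : seq (R * M)) : V :=
  \sum_(ax <- s) ax.1 *: f ax.2.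

(* The span of the delta x, taken among all functions on based_fun rather than
   among the linear functionals: the span is the same. *)
Definition molecule_pred : {pred based_fun -> R} := fun mu =>
  `[< exists s : seq (R * M), mu = lincomb delta s >].

Lemma lincomb_cat (V : lmodType R) (f : M -> V) s t :
  lincomb f (s ++ t) = lincomb f s + lincomb f t.
Proof. by rewrite /lincomb big_cat. Qed.

Definition scale_comb (c : R) (s : seq (R * M)) := [seq (c * ax.1, ax.2) | ax <- s].

Lemma lincomb_scale (V : lmodType R) (f : M -> V) c s :
  lincomb f (scale_comb c s) = c *: lincomb f s.
Proof.
by rewrite /lincomb big_map scaler_sumr; apply: eq_bigr => ax _; rewrite scalerA.
Qed.

Lemma molecule_submod_closed : submod_closed molecule_pred.
Proof.
split; first by apply/asboolP; exists [::]; rewrite /lincomb big_nil.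
move=> c mu nu /asboolP[s ->] /asboolP[t ->]; apply/asboolP.
by exists (scale_comb c s ++ t); rewrite lincomb_cat lincomb_scale.
Qed.

HB.instance Definition _ := GRing.isSubmodClosed.Build R (based_fun -> R)
  molecule_pred molecule_submod_closed.

Record molecule := Molecule {
  molecule_val :> based_fun -> R;
  _ : molecule_val \in molecule_pred }.

HB.instance Definition _ := [isSub for molecule_val].
HB.instance Definition _ := [Choice of molecule by <:].
HB.instance Definition _ := [SubChoice_isSubLmodule of molecule by <:].

Lemma moleculeP (mu : molecule) : exists s, molecule_val mu = lincomb delta s.
Proof. by apply/asboolP; exact: (valP mu). Qed.

Lemma lincomb_delta_coef s (x : M) : x <> pm_base M ->
  lincomb delta s = 0 -> \sum_(ax <- s | `[< ax.2 = x >]) ax.1 = 0.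
Proof.
move=> xb /(congr1 (fun mu => mu
  (exist (fun f : M -> R => f (pm_base M) = 0) (fun y => (`[< y = x >])%:R) _))).
have hb : (`[< pm_base M = x >])%:R = 0 :> R.
  by rewrite asboolF// => /esym.
move=> /(_ hb); rewrite /lincomb fct_sumE => s0; rewrite -[RHS]s0.
rewrite [RHS](bigID (fun ax : R * M => `[< ax.2 = x >]))/= [X in _ + X]big1 ?addr0.
  by apply: eq_bigr => ax xE;
     rewrite -[RHS]/(ax.1 * (`[< ax.2 = x >])%:R) xE mulr1.
by move=> ax /negbTE xE;
   rewrite -[LHS]/(ax.1 * (`[< ax.2 = x >])%:R) xE mulr0.
Qed.

Lemma lincomb_block (V : lmodType R) (f : M -> V) s (x : M) :
  f (pm_base M) = 0 -> lincomb delta s = 0 ->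
  \sum_(ax <- s | `[< ax.2 = x >]) ax.1 *: f ax.2 = 0.
Proof.
move=> fb s0; rewrite (eq_bigr (fun ax => ax.1 *: f x)); last first.
  by move=> ax /asboolP ->.
rewrite -scaler_suml; have [->|xb] := pselect (x = pm_base M).
  by rewrite fb scaler0.
by rewrite lincomb_delta_coef// scale0r.
Qed.

Lemma lincomb_delta0 (V : lmodType R) (f : M -> V) s :
  f (pm_base M) = 0 -> lincomb delta s = 0 -> lincomb f s = 0.
Proof.
move=> fb; have [n] := ubnP (size s); elim: n s => // n IH [|[a x] s] sn s0.
  by rewrite /lincomb big_nil.
pose t := [seq ax <- (a, x) :: s | ~~ `[< ax.2 = x >]].
have tE (W : lmodType R) (g : M -> W) : g (pm_base M) = 0 ->
    lincomb g ((a, x) :: s) = lincomb g t.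
  move=> gb; rewrite {1}/lincomb (bigID (fun ax : R * M => `[< ax.2 = x >]))/=.
  by rewrite (lincomb_block x gb s0) add0r /lincomb big_filter.
rewrite (tE _ f fb); apply: IH.
  have sn' : (size s < n)%N by [].
  by rewrite /t /= asboolT//= size_filter; exact: leq_ltn_trans (count_size _ _) sn'.
rewrite -(tE _ delta)//.
by apply/funext => -[g gb].
Qed.

Lemma lincomb_delta_eq (V : lmodType R) (f : M -> V) s t :
  f (pm_base M) = 0 -> lincomb delta s = lincomb delta t ->
  lincomb f s = lincomb f t.
Proof.
move=> fb st; apply/eqP; rewrite -subr_eq0 -scaleN1r -lincomb_scale -lincomb_cat.
apply/eqP/lincomb_delta0 => //.
by rewrite lincomb_cat lincomb_scale st scaleN1r subrr.
Qed.

(* The values of the norms of sum_j a_j f(x_j), over all representations of mu,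
   all p-normed spaces Y and all 1-Lipschitz f vanishing at the base point; by lincomb_delta_eq the choice of
   the representation is immaterial. *)
Definition molecule_norm_set (mu : molecule) : set R :=
  [set r | exists (s : seq (R * M)) (Y : pNormedSpace p) (f : M -> Y),
    [/\ molecule_val mu = lincomb delta s, lipschitz1 f, f (pm_base M) = 0 &
        r = pnorm (lincomb f s)]].

Definition molecule_norm (mu : molecule) : R := sup (molecule_norm_set mu).

Let p_gt0 : 0 < p. Proof. by case/andP: (pm_exponent M). Qed.

Lemma molecule_norm_bounded mu : has_ubound (molecule_norm_set mu).
Proof.
have [s0 mus0] := moleculeP mu.
exists ((\sum_(ax <- s0) (`|ax.1| * pdist ax.2 (pm_base M)) `^ p) `^ p^-1).
move=> _ [s [Y [f [mus lf fb ->]]]].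
rewrite (lincomb_delta_eq fb (etrans (esym mus) mus0)).
rewrite -(powRK p_gt0 (pnorm_ge0 (lincomb f s0))) ler_powR2 ?invr_gt0 ?powR_ge0//.
  apply: le_trans (ler_pnorm_sum _ _) _; apply: ler_sum => -[a x] _ /=.
  rewrite ler_powR2 ?pnorm_ge0 ?mulr_ge0 ?pdist_ge0// pnormZ ler_wpM2l//.
  by rewrite -{1}[f x]subr0 -fb; exact: lf.
by apply: sumr_ge0 => ax _; exact: powR_ge0.
Qed.

Lemma molecule_norm_nonempty mu : molecule_norm_set mu !=set0.
Proof.
have [s mus] := moleculeP mu.
exists (pnorm (lincomb (fun=> 0 : ellp (pm_exponent M)) s)).
exists s, (ellp (pm_exponent M)), (fun=> 0); split=> // x y.
by rewrite subrr pnorm0 pdist_ge0.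
Qed.

Lemma molecule_norm_has_sup mu : has_sup (molecule_norm_set mu).
Proof.
by split; [exact: molecule_norm_nonempty | exact: molecule_norm_bounded].
Qed.

Lemma molecule_norm_ub mu s (Y : pNormedSpace p) (f : M -> Y) :
  molecule_val mu = lincomb delta s -> lipschitz1 f -> f (pm_base M) = 0 ->
  pnorm (lincomb f s) <= molecule_norm mu.
Proof.
move=> mus lf fb; apply: sup_ubound; first exact: molecule_norm_bounded.
by exists s, Y, f.
Qed.

Lemma molecule_norm_le mu s (b : R) : molecule_val mu = lincomb delta s ->
  (forall (Y : pNormedSpace p) (f : M -> Y), lipschitz1 f -> f (pm_base M) = 0 ->
     pnorm (lincomb f s) <= b) ->
  molecule_norm mu <= b.
Proof.
move=> mus h; apply: ge_sup; first exact: molecule_norm_nonempty.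
move=> _ [t [Y [f [mut lf fb ->]]]].
by rewrite (lincomb_delta_eq fb (etrans (esym mut) mus)); exact: h.
Qed.

Fact molecule_norm_ge0 mu : 0 <= molecule_norm mu.
Proof.
have [r [s [Y [f [mus lf fb _]]]]] := molecule_norm_nonempty mu.
exact: le_trans (pnorm_ge0 _) (molecule_norm_ub mus lf fb).
Qed.

Lemma molecule_normZ_le (a : R) mu : molecule_norm (a *: mu) <= `|a| * molecule_norm mu.
Proof.
have [s mus] := moleculeP mu.
apply: (@molecule_norm_le _ (scale_comb a s)); first by rewrite lincomb_scale -mus.
move=> Y f lf fb; rewrite lincomb_scale pnormZ ler_wpM2l//.
exact: molecule_norm_ub.
Qed.

Fact molecule_normZ (a : R) mu : molecule_norm (a *: mu) = `|a| * molecule_norm mu.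
Proof.
apply/le_anti; rewrite molecule_normZ_le/=.
have [->|a0] := eqVneq a 0; first by rewrite normr0 mul0r molecule_norm_ge0.
have := molecule_normZ_le a^-1 (a *: mu).
by rewrite scalerA mulVf// scale1r normfV mulrC ler_pdivlMr ?normr_gt0// mulrC.
Qed.

Fact molecule_normD mu nu : molecule_norm (mu + nu) `^ p <=
  molecule_norm mu `^ p + molecule_norm nu `^ p.
Proof.
have [s mus] := moleculeP mu; have [t nut] := moleculeP nu.
set b := (leRHS); have b0 : 0 <= b by rewrite addr_ge0 ?powR_ge0.
rewrite -(powRVK p_gt0 b0) ler_powR2 ?molecule_norm_ge0 ?powR_ge0//.
apply: (@molecule_norm_le _ (s ++ t)); first by rewrite lincomb_cat -mus -nut.
move=> Y f lf fb; rewrite -(ler_powR2 p_gt0) ?pnorm_ge0 ?powR_ge0// powRVK//.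
rewrite lincomb_cat; apply: le_trans (pnormD _ _) _.
by apply: lerD; rewrite ler_powR2 ?pnorm_ge0 ?molecule_norm_ge0//;
   exact: molecule_norm_ub.
Qed.

Definition molecule_space : pSeminormedSpace p :=
  PSeminormedSpace (pm_exponent M) molecule_norm_ge0 molecule_normZ
    molecule_normD.

(* molecule_norm is in fact a p-norm, so that completion identifies no two
   molecules; completion accepts p-seminorms because it divides by the null
   sequences anyway, and definiteness is therefore not proved here. *)
Definition lipschitz_free : pNormedSpace p := completion molecule_space.

End free_space.

Section snowflake.
Variables (R : realType) (p : R) (p01 : 0 < p <= 1) (M : set R) (x0 : M).

Let p_gt0 : 0 < p. Proof. by case/andP: p01. Qed.

Definition snowflake_dist (x y : M) : R := `|val x - val y| `^ p^-1.

Fact snowflake_dist_ge0 x y : 0 <= snowflake_dist x y.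
Proof. exact: powR_ge0. Qed.

Fact snowflake_dist_eq0 x y : snowflake_dist x y = 0 <-> x = y.
Proof.
split=> [/powR_eq0_eq0/normr0_eq0/subr0_eq/val_inj //|->].
by rewrite /snowflake_dist subrr normr0 powR0// invr_neq0// gt_eqF.
Qed.

Fact snowflake_distC x y : snowflake_dist x y = snowflake_dist y x.
Proof. by rewrite /snowflake_dist distrC. Qed.

Fact snowflake_dist_triangle x y z : snowflake_dist x y `^ p <=
  snowflake_dist x z `^ p + snowflake_dist z y `^ p.
Proof. by rewrite !powRVK// ler_distD. Qed.

Definition snowflake : pointedPMetricSpace p :=
  PointedPMetricSpace x0 p01 snowflake_dist_ge0 snowflake_dist_eq0
    snowflake_distC snowflake_dist_triangle.

End snowflake.

(* Main.v *)
From HB Require Import structures.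
Require Import Defs.
From mathcomp Require Import all_boot all_order all_algebra.
From mathcomp Require Import all_classical all_reals all_analysis.
Import Order.TTheory GRing.Theory Num.Theory.
Import numFieldNormedType.Exports.

Set Implicit Arguments.
Unset Strict Implicit.
Unset Printing Implicit Defensive.

Local Open Scope classical_set_scope.
Local Open Scope ring_scope.

(** Let [K] be the closure of [M]. Its complement splits into open intervals; the
    bounded ones, the gaps of [K], have both ends in [K]. As [K] is null, the
    gaps between two points [x <= y] of [K] fill [[x, y]] up to a null set, so
    their lengths add up to [y - x] (lemma [gaps_sum]). Consequently there are
    countably infinitely many gaps (lemmas [countable_gaps] and
    [infinite_gaps]), and sending a point [x] to the sequence whose coordinate
    at a gap of length [w] is, up to sign, [w `^ p^-1] if the gap separates [x]
    from the base point and [0] otherwise embeds [K] into [l_p] with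
    [`|x - y|] as the p-th power of the distance
    (lemma [gap_embedding_dist]).

    The linear extension of this 1-Lipschitz map to the molecules does not
    increase the norm, by the very definition of the free norm. It does not
    decrease it either: after telescoping, a molecule is a combination
    [\sum_i c_i (delta y_(i+1) - delta y_i)] along increasing points [y_i].
    The triangle inequality bounds the p-th power of its image under any
    1-Lipschitz map by [\sum_i `|c_i| `^ p * (y_(i+1) - y_i)], and the
    embedding attains this bound because distinct increments have disjoint
    supports in [l_p] (lemma [balanced_norm]).

    The image is dense: the ends of a gap are limits of points of [M], and the
    images of the two ends differ by a multiple of a unit vector (lemmas
    [basis_vectorE] and [approximable_ellp]). Since [l_p] is complete, the
    isometry extends to an isometric isomorphism of the completion
    (lemma [completion_isometric]).

    The range of a monotone sequence has at most one limit point outside of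
    itself, so its closure is countable, hence null. *)

(** * Isometries with dense range extend to the completion *)

Section pconvergence.
Variables (R : realType) (p : R) (X : pSeminormedSpace p).
Implicit Types (u v : nat -> X) (x y l : X).

Definition pcvg u l := (fun n => pnorm (u n - l) `^ p) @ \oo --> 0.

Definition pcomplete :=
  forall u, u \in cauchy_pred (X := X) -> exists l, pcvg u l.

Lemma pnormB_powR x y z :
  pnorm (x - y) `^ p <= pnorm (x - z) `^ p + pnorm (z - y) `^ p.
Proof. by rewrite -[x - y](subrKA z) pnormD. Qed.

Lemma pcvg_norm u l : pcvg u l ->
  (fun n => pnorm (u n) `^ p) @ \oo --> pnorm l `^ p.
Proof.
move=> ul; apply/subr_cvg0; apply: norm_cvg0.
apply: (@squeeze_cvgr _ _ _ _ (cst 0) (fun n => pnorm (u n - l) `^ p)) => //.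
  by apply: nearW => n /=; rewrite normr_ge0 ler_pdist.
exact: cvg_cst.
Qed.

Lemma pcvg_linear u v l l' (a : R) : pcvg u l -> pcvg v l' ->
  pcvg (fun n => a *: u n + v n) (a *: l + l').
Proof.
move=> ul vl; apply: (@squeeze_cvgr _ _ _ _ (cst 0)
  (fun n => `|a| `^ p * pnorm (u n - l) `^ p + pnorm (v n - l') `^ p)).
- apply: nearW => n; rewrite powR_ge0/= -powRM ?pnorm_ge0// -pnormZ.
  by rewrite opprD addrACA -scalerBr pnormD.
- exact: cvg_cst.
- rewrite -[0](addr0 0) -[X in X + _](mulr0 (`|a| `^ p)).
  by apply: cvgD => //; apply: cvgM => //; exact: cvg_cst.
Qed.

Lemma pcvg_cauchy u l : pcvg u l -> u \in cauchy_pred (X := X).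
Proof.
move=> ul; apply/cauchy_predP => e e0.
move/cvgrPdist_lt : ul => /(_ _ (divr_gt0 e0 (ltr0n _ 2)))[N _ hN].
exists N => m n Nm Nn; apply: le_lt_trans (pnormB_powR _ _ l) _.
rewrite [ltRHS]splitr; apply: ltrD.
  by have := hN _ Nm; rewrite /= sub0r normrN ger0_norm ?powR_ge0.
by have := hN _ Nn; rewrite /= sub0r normrN ger0_norm ?powR_ge0// pdistrC.
Qed.

End pconvergence.

Lemma pcvg_unique (R : realType) (p : R) (Y : pNormedSpace p) (u : nat -> Y)
  (l l' : Y) : pcvg u l -> pcvg u l' -> l = l'.
Proof.
move=> ul ul'.
have := pcvg_norm (pcvg_linear (-1) ul ul').
have -> : (fun n => pnorm (-1 *: u n + u n) `^ p) = cst (0 : R).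
  by apply/funext => n; rewrite scaleN1r addNr pnorm0 powR0// gt_eqF// (pn_gt0 Y).
move=> h; have : pnorm (-1 *: l + l') `^ p = 0.
  exact: (cvg_unique (@norm_hausdorff _ _) h (cvg_cst 0)).
by move=> /powR_eq0_eq0/pnorm0_eq0; rewrite scaleN1r addrC => /subr0_eq.
Qed.

Section extension_to_completion.
Variables (R : realType) (p : R) (X : pSeminormedSpace p) (Y : pNormedSpace p).
Variable T : {linear X -> Y}.
Hypothesis T_isometric : forall x, pnorm (T x) = pnorm x.

Lemma cauchy_image (u : nat -> X) :
  ((fun n => T (u n)) \in cauchy_pred (X := Y)) = (u \in cauchy_pred (X := X)).
Proof.
by rewrite !unfold_in; congr asbool; apply/propext; split => h e /h[N hN];
  exists N => m n Nm Nn; have := hN m n Nm Nn; rewrite -linearB T_isometric.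
Qed.

(** The extension sends the class of a Cauchy sequence to the limit of its
    image. It is still isometric, hence injective, and it is onto because a
    sequence whose image under an isometry converges is Cauchy. *)
Lemma completion_isometric : pcomplete Y ->
  (forall (y : Y) (e : R), 0 < e -> exists x, pnorm (y - T x) `^ p < e) ->
  isometrically_isomorphic (completion X) Y.
Proof.
move=> Ycomplete Tdense.
have limT (u : cauchySeq X) : exists l, pcvg (fun n => T (u n)) l.
  by apply: Ycomplete; rewrite cauchy_image; exact: valP.
pose F (x : completion X) : Y := sval (cid (limT (repr x))).
have FE (u : cauchySeq X) l : pcvg (fun n => T (u n)) l -> F (completion_pi u) = l.
  move=> ul; rewrite /F; case: cid => l' /= ul'.
  apply: pcvg_unique ul' _.
  have /completion_eqP/pnorm_cvg0 vu := completion_repr u.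
  apply: (@squeeze_cvgr _ _ _ _ (cst 0) (fun n =>
     pnorm (repr (completion_pi u) n - u n) `^ p + pnorm (T (u n) - l) `^ p)).
  - apply: nearW => n; rewrite powR_ge0/=.
    apply: le_trans (pnormB_powR _ _ (T (u n))) _.
    by rewrite -linearB T_isometric.
  - exact: cvg_cst.
  - by rewrite -[0]addr0; apply: cvgD.
have Flinear : linear F.
  move=> a x y; elim/completion_ind: x => u; elim/completion_ind: y => v.
  rewrite -completion_piZ -completion_piD.
  have [l ul] := limT u; have [l' vl'] := limT v.
  rewrite (FE u l)// (FE v l')//; apply: FE.
  have := pcvg_linear a ul vl'; apply: cvg_trans.
  by apply: near_eq_cvg; apply: nearW => n /=; rewrite -linearP.
pose FL := HB.pack_for {linear completion X -> Y} F
  (@GRing.isLinear.Build _ _ _ _ F Flinear).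
have Fnorm x : pnorm (FL x) = pnorm x.
  elim/completion_ind: x => u; have [l ul] := limT u.
  rewrite [FL _](FE u l)// [RHS]completion_normE.
  apply: (powR_injective (pn_gt0 X)); rewrite ?nnegrE ?pnorm_ge0 ?cauchy_norm_ge0//.
  apply: cvg_unique (pcvg_norm ul) _ => //.
  have := @cauchy_norm_powR_cvg _ _ _ u; apply: cvg_trans.
  by apply: near_eq_cvg; apply: nearW => n /=; rewrite T_isometric.
have Fsurj y : exists x, F x = y.
  have /choice[u uy] : forall n : nat, exists x, pnorm (y - T x) `^ p < n.+1%:R^-1.
    by move=> n; apply: Tdense; rewrite invr_gt0.
  have Tuy : pcvg (fun n => T (u n)) y.
    apply: (@squeeze_cvgr _ _ _ _ (cst 0) (@harmonic R)).
    - by apply: nearW => n; rewrite powR_ge0/= pdistrC; exact/ltW/uy.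
    - exact: cvg_cst.
    - exact: cvg_harmonic.
  have cu : u \in cauchy_pred (X := X) by rewrite -cauchy_image; exact: pcvg_cauchy Tuy.
  by exists (completion_pi (CauchySeq cu)); exact: FE.
exists FL; split => //; have [G FG] := choice Fsurj.
exists G => // x; apply/eqP; rewrite -subr_eq0; apply/eqP/pnorm0_eq0.
by rewrite -Fnorm linearB [FL (G _)]FG subrr pnorm0.
Qed.

End extension_to_completion.

(** * Completeness of l_p *)

Section ellp_complete.
Variables (R : realType) (p : R) (p01 : 0 < p <= 1).
Let p_gt0 : 0 < p. Proof. by case/andP: p01. Qed.

Lemma ellp_partial_sum_le (u : ellp p01) n :
  \sum_(0 <= k < n) `|u k| `^ p <= pnorm u `^ p.
Proof.
have nd : nondecreasing_seq (series (fun n => `|u n| `^ p)).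
  by apply: nondecreasing_series => i _ _; exact: powR_ge0.
have := nondecreasing_cvgn_le nd (@ellp_summable _ _ _ u) n.
by rewrite -ellp_normE.
Qed.

Lemma ellp_norm_le (u : ellp p01) (c : R) :
  (forall n, \sum_(0 <= k < n) `|u k| `^ p <= c) -> pnorm u `^ p <= c.
Proof.
move=> h; rewrite [X in X `^ _]/= ellp_normE.
by apply: limr_le; [exact: ellp_summable | exact: nearW].
Qed.

Lemma summable_bounded (u : nat -> R) (c : R) :
  (forall n, \sum_(0 <= k < n) `|u k| `^ p <= c) -> u \in summable_pred p01.
Proof.
move=> h; apply/summable_predP; apply: nondecreasing_is_cvgn.
  by apply: nondecreasing_series => i _ _; exact: powR_ge0.
by exists c => _ [n _ <-]; exact: h.
Qed.

Lemma ellp_coord_le (u : ellp p01) n : `|u n| `^ p <= pnorm u `^ p.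
Proof.
apply: le_trans (ellp_partial_sum_le u n.+1); rewrite big_nat_recr//= lerDr.
by apply: sumr_ge0 => i _; exact: powR_ge0.
Qed.

(** A Cauchy sequence converges coordinatewise; its distance to the coordinatewise
    limit is controlled through partial sums, which pass to the limit. *)
Lemma ellp_complete : pcomplete (ellp p01).
Proof.
move=> u uC.
have /choice[v uv] : forall k, exists l : R, (fun n => (u n : ellp p01) k) @ \oo --> l.
  move=> k; apply/cvg_ex/cauchy_cvgP/cauchy_exP => e e0.
  move/cauchy_predP : uC => /(_ (e `^ p)); rewrite powR_gt0// => /(_ isT)[N hN].
  exists ((u N : ellp p01) k); exists N => // n /= Nn.
  rewrite /ball/= -(ltr_powR2 p_gt0)// ?(ltW e0)//.
  by apply: le_lt_trans (hN N n _ Nn) => //; exact: (ellp_coord_le (u N - u n)).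
have tail (e : R) : 0 < e -> exists N : nat, forall n, (N <= n)%N -> forall m : nat,
    \sum_(0 <= k < m) `|(u n : ellp p01) k - v k| `^ p <= e.
  move=> e0; move/cauchy_predP : (uC) => /(_ _ e0)[N hN]; exists N => n Nn m.
  have h : (fun i => \sum_(0 <= k < m) `|(u n : ellp p01) k - (u i : ellp p01) k| `^ p)
      @ \oo --> \sum_(0 <= k < m) `|(u n : ellp p01) k - v k| `^ p.
    apply: cvg_big => [|k _]; first exact: add_continuous.
    apply: cvg_powR => //.
    by apply: cvg_norm; apply: cvgB => //; exact: cvg_cst.
  apply: (ler_cvg_to h (cvg_cst e)); exists N => // i /= Ni.
  exact: le_trans (ellp_partial_sum_le (u n - u i) m) (ltW (hN n i Nn Ni)).
have [N hN] := tail 1 ltr01.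
have vS : v \in summable_pred p01.
  have -> : v = ellp_val (u N) - (fun k => ellp_val (u N) k - v k).
    by apply/funext => k; rewrite -[RHS]/(_ - (_ - _)) subKr.
  by rewrite rpredB//; [exact: valP | apply: (@summable_bounded _ 1); exact: hN].
exists (EllpSort vS); apply/cvgrPdist_le => e e0.
have [N' hN'] := tail _ e0; exists N' => // n /= Nn.
rewrite sub0r normrN ger0_norm ?powR_ge0//.
exact: (@ellp_norm_le (u n - EllpSort vS) e (hN' n Nn)).
Qed.

End ellp_complete.

(** * Gaps of a closed null subset of the line *)

Section gaps.
Variable R : realType.
Implicit Types (K : set R) (x y z : R) (I J : R * R).

(** The bounded components of the complement of a closed set, each given by its
    pair of ends. *)
Definition gaps K : set (R * R) :=
  [set I | [/\ K I.1, K I.2, I.1 < I.2 &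
     forall z, K z -> z <= I.1 \/ I.2 <= z]].

Lemma gap_disjoint K I J z : gaps K I -> gaps K J ->
  I.1 < z < I.2 -> J.1 < z < J.2 -> I = J.
Proof.
have le2 I' J' : gaps K I' -> gaps K J' ->
    I'.1 < z < I'.2 -> J'.1 < z < J'.2 -> I'.1 <= J'.1 /\ I'.2 <= J'.2.
  move=> [kI1 kI2 I12 gI] [kJ1 kJ2 J12 gJ] /andP[I1z zI2] /andP[J1z zJ2].
  split.
    have [//|J2I1] := gJ _ kI1.
    by have := lt_trans I1z (lt_le_trans zJ2 J2I1); rewrite ltxx.
  have [J2I1|//] := gI _ kJ2.
  by have := lt_trans I1z (lt_le_trans zJ2 J2I1); rewrite ltxx.
move=> gI gJ zI zJ; have [a1 a2] := le2 _ _ gI gJ zI zJ.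
have [b1 b2] := le2 _ _ gJ gI zJ zI.
by apply: injective_projections; apply/le_anti; rewrite ?a1 ?a2 ?b1 ?b2.
Qed.

Lemma closure_inf (B : set R) : B !=set0 -> has_lbound B -> closure B (inf B).
Proof.
move=> B0 hB U /nbhs_ballP[e /= e0 eU].
have [t Bt te] := inf_adherent e0 (conj B0 hB).
exists t; split => //; apply: eU; rewrite /ball/= distrC ger0_norm ?ltrBlDl//.
by rewrite subr_ge0; exact: ge_inf.
Qed.

(** The ends are the last point of [K] before [z] and the first one after it. *)
Lemma gap_around K x y z : closed K -> K x -> K y -> x < z < y -> ~ K z ->
  exists I, [/\ gaps K I, x <= I.1, I.2 <= y & I.1 < z < I.2].
Proof.
move=> cK Kx Ky /andP[xz zy] nKz.
pose A := K `&` [set t | t <= z]; pose B := K `&` [set t | z <= t].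
have A0 : A !=set0 by exists x; split => //; exact: ltW.
have B0 : B !=set0 by exists y; split => //; exact: ltW.
have hA : has_ubound A by exists z => t [].
have hB : has_lbound B by exists z => t [].
have cA : closed A by apply: closedI => //; exact: closed_le.
have cB : closed B by apply: closedI => //; exact: closed_ge.
have [KA Az] : A (sup A) by apply: cA; exact: closure_sup.
have [KB zB] : B (inf B) by apply: cB; exact: closure_inf.
have Alt : sup A < z by rewrite lt_neqAle Az andbT; apply/eqP => e; rewrite e in KA.
have Blt : z < inf B by rewrite lt_neqAle zB andbT; apply/eqP => e; rewrite -e in KB.
exists (sup A, inf B); split => /=; last by rewrite Alt Blt.
- split => //=; first exact: lt_trans Blt.
  move=> t Kt; have [tz|zt] := leP t z.
    by left; apply: ub_le_sup => //; split.
  by right; apply: ge_inf => //; split => //; exact: ltW.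
- by apply: ub_le_sup => //; split => //; exact: ltW.
- by apply: ge_inf => //; split => //; exact: ltW.
Qed.

(** Disjoint intervals contain distinct rationals. *)
Lemma countable_gaps K : countable (gaps K).
Proof.
have /choice[q qP] : forall I, exists r : rat, gaps K I -> I.1 < ratr r < I.2.
  move=> I; have [[_ _ I12 _]|nI] := pselect (gaps K I); last by exists 0.
  by have [r] := rat_in_itvoo I12; rewrite in_itv/= => h; exists r.
apply/countable_injP.
have /countable_injP[f fi] := countableP [set: rat].
exists (f \o q) => I J; rewrite !inE => gI gJ /= fq.
have qq : q I = q J by apply: fi => //; rewrite inE.
apply: (gap_disjoint gI gJ (qP _ gI)); rewrite qq; exact: qP.
Qed.

Variable K : set R.
Hypotheses (K_closed : closed K) (K_null : lebesgue_measure K = 0%E).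

Let mK : measurable K. Proof. exact: measurable_realfun.closed_measurable. Qed.

(** A null set cannot contain the interval between two of its points. *)
Lemma null_gap_between x y : K x -> K y -> x < y ->
  exists I, [/\ gaps K I, x <= I.1 & I.2 <= y].
Proof.
move=> Kx Ky xy.
have [z [xzy nKz]] : exists z, x < z < y /\ ~ K z.
  apply: contrapT => h.
  have : (lebesgue_measure (`]x, y[%classic : set R) <= lebesgue_measure K)%E.
    apply: le_measure; rewrite ?inE; [exact: measurable_itv | exact: mK |].
    move=> z /=; rewrite in_itv/= => xzy; apply: contrapT => nKz.
    by apply: h; exists z.
  by rewrite K_null lebesgue_measure_itv/= lte_fin xy -EFinB lee_fin subr_le0 leNgt xy.
by have [I [gI xI Iy _]] := gap_around K_closed Kx Ky xzy nKz; exists I.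
Qed.

(** Counting the right ends of gaps to the left of a point is strictly increasing
    on [K], so finitely many gaps would leave room for finitely many points. *)
Lemma infinite_gaps : infinite_set K -> infinite_set (gaps K).
Proof.
move=> Kinf /finite_seqP[s gs]; apply: Kinf.
pose h x := count (fun I : R * R => I.2 <= x) s.
have h_lt x y : K x -> K y -> x < y -> (h x < h y)%N.
  move=> Kx Ky xy; have [I [gI xI Iy]] := null_gap_between Kx Ky xy.
  have sI : I \in s by rewrite gs in gI.
  have I12 : I.1 < I.2 by case: gI.
  have -> : h y = (h x + count (fun I : R * R => x < I.2 <= y)%R s)%N.
    rewrite -count_predUI addnC [X in (X + _)%N](_ : _ = 0%N); last first.
      by rewrite -[RHS](count_pred0 s); apply: eq_count => J /=; case: leP.
    by apply: eq_count => J /=; case: leP => //= Jx; rewrite (le_trans Jx (ltW xy)).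
  rewrite -[ltnLHS]addn0 ltn_add2l -has_count; apply/hasP; exists I => //.
  by rewrite Iy (le_lt_trans xI I12).
have h_inj : {in K &, injective h}.
  move=> x y; rewrite !inE => Kx Ky hxy.
  by case: (ltgtP x y) => // xy; [have := h_lt _ _ Kx Ky xy | have := h_lt _ _ Ky Kx xy];
    rewrite hxy ltnn.
rewrite -(eq_finite_set (inj_card_eq h_inj)).
apply: (@sub_finite_set _ _ `I_(size s).+1); last exact: finite_II.
by move=> _ [x _ <-] /=; rewrite ltnS count_size.
Qed.

(** Countable additivity: the gaps between [x] and [y] cover [[x, y]] up to
    the null set [K]. Since no point of [K] lies inside a gap, a gap lies between
    [x] and [y] as soon as its right end lies in []x, y]]. *)
Lemma gaps_sum (g : nat -> R * R) : set_bij [set: nat] (gaps K) g ->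
  forall x y, K x -> K y -> x <= y ->
  series (fun n => if x < (g n).2 <= y then (g n).2 - (g n).1 else 0) @ \oo
    --> y - x.
Proof.
move=> [gK ginj gsurj] x y Kx Ky xy.
pose P n := x < (g n).2 <= y.
have gP n : gaps K (g n) by exact: gK.
have g12 n : (g n).1 < (g n).2 by case: (gP n).
pose F n : set R := if P n then `](g n).1, (g n).2[%classic else set0.
have mF n : measurable (F n) by rewrite /F; case: ifP => _; [exact: measurable_itv|].
have tF : trivIset setT F.
  move=> i j _ _ [z []]; rewrite /F; case: ifP => // _; case: ifP => // _.
  rewrite /= !in_itv/= => zi zj; apply: ginj; rewrite ?inE//.
  exact: gap_disjoint zi zj.
have muF n : lebesgue_measure (F n) =
    (if P n then (g n).2 - (g n).1 else 0)%:E.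
  rewrite /F; case: ifP => _; last by rewrite measure0.
  by rewrite lebesgue_measure_itv/= lte_fin g12 EFinB.
have mU : measurable (\bigcup_n F n) by exact: bigcup_measurable.
have muU : lebesgue_measure (\bigcup_n F n) = (y - x)%:E.
  have mxy : lebesgue_measure (`[x, y]%classic : set R) = (y - x)%:E.
    rewrite lebesgue_measure_itv/= lte_fin; case: ltgtP xy => // -> _.
    by rewrite subrr.
  apply/le_anti/andP; split; rewrite -mxy.
    apply: le_measure; rewrite ?inE; [exact: mU | exact: measurable_itv |].
    move=> z [n _]; rewrite /F; case: ifP => //= /andP[xg gy].
    rewrite !in_itv/= => /andP[gz zg]; rewrite (ltW (lt_le_trans zg gy)) andbT.
    have [_ _ _ /(_ _ Kx)[h|h]] := gP n; last by rewrite leNgt xg in h.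
    by rewrite (ltW (le_lt_trans h gz)).
  rewrite -[leRHS]adde0 -K_null.
  apply: (@le_trans _ _ (lebesgue_measure (\bigcup_n F n `|` K))); last first.
    by apply: measureU2; [exact: mU | exact: mK].
  have mUK : measurable (\bigcup_n F n `|` K) by exact: measurableU.
  apply: le_measure; rewrite ?inE; [exact: measurable_itv | exact: mUK |].
  move=> z; rewrite /=; rewrite in_itv/= => /andP[xz zy].
  have [Kz|nKz] := pselect (K z); [by right|left].
  have xzy : x < z < y.
    rewrite !lt_neqAle xz zy !andbT; apply/andP; split; apply/eqP => e.
      by rewrite e in Kx.
    by rewrite -e in Ky.
  have [I [gI xI Iy zI]] := gap_around K_closed Kx Ky xzy nKz.
  have [n _ gn] := gsurj _ gI; exists n => //; rewrite /F /P gn Iy andbT.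
  case/andP: (zI) => I1z zI2.
  by rewrite (le_lt_trans xz zI2)/= in_itv/= zI.
have : (fun n => \sum_(0 <= i < n) lebesgue_measure (F i))%E @ \oo --> (y - x)%:E.
  by rewrite -muU; exact: measure_semi_sigma_additive.
move=> /fine_cvgP[_]; apply: cvg_trans; apply: near_eq_cvg.
apply: nearW => n /=; rewrite /series/=.
by rewrite (eq_bigr _ (fun i _ => muF i)) sumEFin.
Qed.

End gaps.

(** * Linear extension to molecules *)

Section linear_extension.
Variables (R : realType) (p : R) (M : pointedPMetricSpace p) (V : lmodType R).
Variables (F : M -> V) (F0 : F (pm_base M) = 0).

Definition molecule_ext (mu : molecule_space M) : V :=
  lincomb F (sval (cid (moleculeP mu))).

Lemma molecule_extE (mu : molecule_space M) s :
  molecule_val mu = lincomb (@delta _ _ M) s -> molecule_ext mu = lincomb F s.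
Proof.
by rewrite /molecule_ext; case: cid => t /= -> /(lincomb_delta_eq F0).
Qed.

Lemma molecule_ext_linear : linear molecule_ext.
Proof.
move=> a mu nu; have [s mus] := moleculeP mu; have [t nut] := moleculeP nu.
rewrite (molecule_extE mus) (molecule_extE nut) -lincomb_scale -lincomb_cat.
by apply: molecule_extE; rewrite lincomb_cat lincomb_scale -mus -nut.
Qed.

Lemma dirac_subproof (x : M) :
  lincomb (@delta _ _ M) [:: (1, x)] \in @molecule_pred _ _ M.
Proof. by apply/asboolP; exists [:: (1, x)]. Qed.

Definition dirac_molecule (x : M) : molecule_space M := Molecule (dirac_subproof x).

Lemma molecule_ext_dirac x : molecule_ext (dirac_molecule x) = F x.
Proof.
by rewrite (@molecule_extE _ [:: (1, x)])// /lincomb big_seq1 scale1r.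
Qed.

End linear_extension.

(** Here [I] need not have a decidable equality: the points of a p-metric space
    have none, so the condition is a predicate instead of list membership. *)
Lemma eq_sum_all (I : Type) (V : nmodType) (P : pred I) (F G : I -> V) (s : seq I) :
  all P s -> (forall i, P i -> F i = G i) ->
  \sum_(i <- s) F i = \sum_(i <- s) G i.
Proof.
move=> + FG; elim: s => [|i s IH]; first by rewrite !big_nil.
by rewrite /= !big_cons => /andP[/FG-> /IH->].
Qed.

(** The proof sorts the indices instead of the entries: being a permutation is a
    decidable relation on lists of numbers, but not on lists of points. *)
Lemma lincomb_sorted (R : realType) (p : R) (M : pointedPMetricSpace p)
  (r : rel M) (s : seq (R * M)) : total r ->
  exists2 t : seq (R * M), sorted (fun u v => r u.2 v.2) t &
    forall (V : lmodType R) (f : M -> V), lincomb f t = lincomb f s.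
Proof.
move=> r_total; pose d := (0 : R, pm_base M).
pose ri i j := r (nth d s i).2 (nth d s j).2.
exists (map (nth d s) (sort ri (iota 0 (size s)))).
  by rewrite sorted_map; apply: sort_sorted => i j; exact: r_total.
move=> V f; rewrite /lincomb big_map (perm_big (iota 0 (size s))).
  by rewrite [in RHS](big_nth d) /index_iota subn0.
by rewrite perm_sort.
Qed.

(** * The embedding by gap coordinates *)

Section gap_coordinates.
Variables (R : realType) (p : R) (p01 : 0 < p <= 1).
Let p_gt0 : 0 < p. Proof. by case/andP: p01. Qed.

Variables (K : set R) (K_closed : closed K) (K_null : lebesgue_measure K = 0%E).
Variables (g : nat -> R * R) (g_bij : set_bij [set: nat] (gaps K) g).

(* The map [h] identifies [S] with a dense subset of [K] whose p-metric is the
   p-th root of the usual distance. *)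
Variables (S : pointedPMetricSpace p) (h : S -> R).
Hypothesis h_isometric : forall x y, pdist x y `^ p = `|h x - h y|.
Hypothesis h_in : forall x, K (h x).
Hypothesis h_dense : forall z (e : R), K z -> 0 < e -> exists x, `|z - h x| < e.

Let gapP n : gaps K (g n).
Proof. by case: g_bij => + _ _; exact. Qed.

Let gap_lt n : (g n).1 < (g n).2. Proof. by case: (gapP n). Qed.

Definition gap_weight n : R := ((g n).2 - (g n).1) `^ p^-1.

Lemma gap_weight_gt0 n : 0 < gap_weight n.
Proof. by rewrite powR_gt0// subr_gt0. Qed.

Lemma gap_weight_powR n : gap_weight n `^ p = (g n).2 - (g n).1.
Proof. by rewrite powRVK// subr_ge0 ltW. Qed.

(** A point [x] of [K] lies beyond a gap exactly if it is at least the right end;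
    subtracting the same test at the base point keeps only the gaps between [x]
    and the base point, whose total length is finite. *)
Definition gap_coord (x : R) (n : nat) : R :=
  gap_weight n * (((g n).2 <= x)%R%:R - ((g n).2 <= h (pm_base S))%R%:R).

Lemma gap_coordB x y n : x <= y ->
  gap_coord y n - gap_coord x n = if x < (g n).2 <= y then gap_weight n else 0.
Proof.
move=> xy; rewrite -mulrBr opprB addrA subrK ltNge.
case: (leP (g n).2 x) => /= [bx|_]; first by rewrite (le_trans bx xy) subrr mulr0.
by case: leP => _; rewrite ?subr0 ?mulr1 ?mulr0.
Qed.

Lemma gap_coord_series x y : K x -> K y ->
  series (fun n => `|gap_coord x n - gap_coord y n| `^ p) @ \oo --> `|x - y|.
Proof.
wlog xy : x y / y <= x => [hw Kx Ky|Kx Ky].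
  have [yx|/ltW xy] := leP y x; first exact: hw.
  by rewrite distrC; under eq_fun do rewrite distrC; exact: hw.
rewrite ger0_norm ?subr_ge0//; have := gaps_sum K_closed K_null g_bij Ky Kx xy.
apply: cvg_trans; apply: near_eq_cvg; apply: nearW => n; apply: eq_bigr => i _.
rewrite gap_coordB//; case: ifP => _; last by rewrite normr0 powR0// gt_eqF.
by rewrite ger0_norm ?gap_weight_powR// ltW// gap_weight_gt0.
Qed.

Lemma gap_coord_base n : gap_coord (h (pm_base S)) n = 0.
Proof. by rewrite /gap_coord subrr mulr0. Qed.

Lemma gap_coord_summable x : K x -> gap_coord x \in summable_pred p01.
Proof.
move=> Kx; apply/summable_predP.
have := gap_coord_series Kx (h_in (pm_base S)).
under eq_fun do rewrite gap_coord_base subr0.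
by move=> /cvgP.
Qed.

(** Summability is established on [K]; [insubd] makes the map total. *)
Definition gap_embedding x : ellp p01 := insubd (0 : ellp_sort p01) (gap_coord x).

Lemma gap_embeddingE x : K x -> ellp_val (gap_embedding x) = gap_coord x.
Proof. by move=> Kx; rewrite /gap_embedding val_insubd gap_coord_summable. Qed.

Lemma gap_embedding_dist x y : K x -> K y ->
  pnorm (gap_embedding x - gap_embedding y) `^ p = `|x - y|.
Proof.
move=> Kx Ky; apply: cvg_unique (gap_coord_series Kx Ky) => //.
have := @ellp_norm_cvg _ _ p01 (gap_embedding x - gap_embedding y).
apply: cvg_trans; apply: near_eq_cvg; apply: nearW => n; apply: eq_bigr => i _.
by rewrite -(gap_embeddingE Kx) -(gap_embeddingE Ky).
Qed.

Definition embedding (x : S) : ellp p01 := gap_embedding (h x).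

Lemma embedding_base : embedding (pm_base S) = 0.
Proof.
apply/val_inj/funext => n /=; rewrite gap_embeddingE//; exact: gap_coord_base.
Qed.

Lemma embedding_lipschitz : lipschitz1 embedding.
Proof.
move=> x y; rewrite -(ler_powR2 p_gt0) ?pnorm_ge0 ?pdist_ge0//.
by rewrite h_isometric gap_embedding_dist.
Qed.

Lemma lincomb_embedding s n :
  ellp_val (lincomb embedding s) n = \sum_(ax <- s) ax.1 * gap_coord (h ax.2) n.
Proof.
elim: s => [|ax s IH]; first by rewrite /lincomb !big_nil.
rewrite big_cons -IH -(gap_embeddingE (h_in _)) /lincomb big_cons.
by [].
Qed.

(** The same [N] bounds the image under every 1-Lipschitz map and is attained by
    the gap coordinates. Moving the weight of the largest point [x] to the next
    one [y] leaves a shorter balanced combination and splits off the term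
    [a (delta x - delta y)]. The gap coordinates of that term live on the gaps
    between [y] and [x], where those of the shorter combination vanish: its
    points all lie on the same side of such a gap and its weights add up to [0].
    Hence the p-th powers of the norms add up. *)
Lemma balanced_norm (s : seq (R * S)) :
  sorted (fun u v => h v.2 <= h u.2) s -> \sum_(ax <- s) ax.1 = 0 ->
  exists N : R, (forall (Y : pNormedSpace p) (f : S -> Y), lipschitz1 f ->
      pnorm (lincomb f s) `^ p <= N) /\
    series (fun n => `|\sum_(ax <- s) ax.1 * gap_coord (h ax.2) n| `^ p)
      @ \oo --> N.
Proof.
have p_neq0 : p != 0 by rewrite gt_eqF.
have [m] := ubnP (size s); elim: m s => // m IH [|[a x] [|[b y] t]] /= sm.
- move=> _ _; exists 0; split=> [Y f _|].
    by rewrite /lincomb big_nil pnorm0 powR0.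
  under eq_fun do rewrite big_nil normr0 powR0//.
  by rewrite /series/=; under eq_fun do rewrite big1//; exact: cvg_cst.
- move=> _; rewrite big_seq1/= => ->; exists 0; split=> [Y f _|].
    by rewrite /lincomb big_seq1 scale0r pnorm0 powR0.
  under eq_fun do rewrite big_seq1/= mul0r normr0 powR0//.
  by rewrite /series/=; under eq_fun do rewrite big1//; exact: cvg_cst.
move=> /andP[yx yt] s0; pose s' := (a + b, y) :: t.
have s'0 : \sum_(ax <- s') ax.1 = 0 by rewrite -[RHS]s0 /s' !big_cons/= addrA.
have ys' : all (fun ax => h ax.2 <= h y) s'.
  rewrite /= lexx/=.
  apply: (order_path_min (leT := fun u v : R * S => h v.2 <= h u.2)) yt.
  by move=> u v w /= vu wv; exact: le_trans wv vu.
have s'_sorted : sorted (fun u v : R * S => h v.2 <= h u.2) s'.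
  by rewrite /s'; move: yt; clear; case: t.
have [N [hN cN]] := IH s' sm s'_sorted s'0.
have coef (W : lmodType R) (f : S -> W) :
    lincomb f [:: (a, x), (b, y) & t] = a *: (f x - f y) + lincomb f s'.
  by rewrite /lincomb /s' !big_cons/= scalerBr scalerDl -!addrA addKr.
have hxy : `|h x - h y| = h x - h y by rewrite ger0_norm// subr_ge0.
exists (`|a| `^ p * (h x - h y) + N); split.
  move=> Y f fl; rewrite coef; apply: le_trans (pnormD _ _) _.
  apply: lerD; last exact: hN.
  rewrite pnormZ powRM ?pnorm_ge0// ler_wpM2l ?powR_ge0//.
  by rewrite -hxy -h_isometric ler_powR2 ?pnorm_ge0 ?pdist_ge0.
set v := series _.
have -> : v = (fun n => `|a| `^ p *
      series (fun n => `|gap_coord (h x) n - gap_coord (h y) n| `^ p) n +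
    series (fun n => `|\sum_(ax <- s') ax.1 * gap_coord (h ax.2) n| `^ p) n).
  apply/funext => n; rewrite /v /series/= mulr_sumr -big_split /=.
  apply: eq_bigr => k _; pose c := \sum_(ax <- s') ax.1 * gap_coord (h ax.2) k.
  have -> : \sum_(ax <- [:: (a, x), (b, y) & t]) ax.1 * gap_coord (h ax.2) k =
      a * (gap_coord (h x) k - gap_coord (h y) k) + c.
    by rewrite /c /s' !big_cons/= mulrBr mulrDl -!addrA addKr.
  rewrite -normr_powRM -/c gap_coordB//; case: ifP => [/andP[yk _]|_]; last first.
    by rewrite mulr0 normr0 powR0// !add0r.
  (* On a gap beyond [y] the coordinate is the same for every point of [s']. *)
  have -> : c = 0; last by rewrite normr0 powR0// !addr0.
  have cE : c = \sum_(ax <- s') ax.1 * - (gap_weight k * ((g k).2 <= h (pm_base S))%R%:R).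
    apply: eq_sum_all ys' _ => ax axy; congr (_ * _).
    by rewrite /gap_coord leNgt (le_lt_trans axy yk) sub0r mulrN.
  by rewrite cE -mulr_suml s'0 mul0r.
apply: cvgD => //; rewrite -hxy.
by apply: cvgM; [exact: cvg_cst | exact: gap_coord_series].
Qed.

(** A map that vanishes at the base point does not see the weight put there, so
    that weight can be chosen to make the combination balanced. *)
Lemma lincomb_le_embedding (s : seq (R * S)) (Y : pNormedSpace p) (f : S -> Y) :
  lipschitz1 f -> f (pm_base S) = 0 ->
  pnorm (lincomb f s) `^ p <= pnorm (lincomb embedding s) `^ p.
Proof.
move=> fl f0.
pose s' := (- \sum_(ax <- s) ax.1, pm_base S) :: s.
have s'E (V : lmodType R) (F : S -> V) : F (pm_base S) = 0 ->
    lincomb F s = lincomb F s'.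
  by move=> F0; rewrite [RHS]/lincomb big_cons F0 scaler0 add0r.
have [t t_sorted tE] := @lincomb_sorted _ _ S (fun u v => h v <= h u) s'
  (fun u v => le_total (h v) (h u)).
have t0 : \sum_(ax <- t) ax.1 = 0.
  (* Written as a combination, the total weight is carried over from [s'] to [t]
     by [tE]. *)
  have sum1 u : \sum_(ax <- u) ax.1 = lincomb (fun=> 1 : R^o) u :> R.
    by apply: eq_bigr => ax _; exact/esym/mulr1.
  by rewrite sum1 tE -sum1 big_cons addNr.
have [N [fN cN]] := balanced_norm t_sorted t0.
rewrite (s'E _ _ f0) (s'E _ _ embedding_base) -!tE.
have -> : pnorm (lincomb embedding t) `^ p = N; last exact: fN.
apply: cvg_unique cN => //.
have := @ellp_norm_cvg _ _ p01 (lincomb embedding t).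
apply: cvg_trans; apply: near_eq_cvg; apply: nearW => n.
by apply: eq_bigr => k _; rewrite -lincomb_embedding.
Qed.

Lemma molecule_ext_norm (mu : molecule_space S) :
  pnorm (molecule_ext embedding mu : ellp p01) = pnorm mu.
Proof.
have [s mus] := moleculeP mu.
rewrite (molecule_extE embedding_base mus); apply/le_anti/andP; split.
  exact: molecule_norm_ub mus embedding_lipschitz embedding_base.
apply: (molecule_norm_le mus) => Y f fl f0.
by rewrite -(ler_powR2 p_gt0) ?pnorm_ge0//; exact: lincomb_le_embedding.
Qed.

(** * Density of the molecules in l_p *)

Definition approximable (v : ellp p01) :=
  forall e : R, 0 < e -> exists mu : molecule_space S,
    pnorm (v - molecule_ext embedding mu) `^ p < e.

Lemma approximable_linear a (v w : ellp p01) :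
  approximable v -> approximable w -> approximable (a *: v + w).
Proof.
move=> av aw e e0.
have a1 : 0 < `|a| `^ p + 1 by rewrite ltr_wpDl// powR_ge0.
have e2 : 0 < e / 2 by rewrite divr_gt0.
have [mu hmu] := av _ (divr_gt0 e2 a1); have [nu hnu] := aw _ e2.
exists (a *: mu + nu); rewrite molecule_ext_linear ?embedding_base//.
rewrite opprD addrACA -scalerBr; apply: le_lt_trans (pnormD _ _) _.
rewrite [ltRHS]splitr; apply: ler_ltD; last exact: hnu.
rewrite pnormZ powRM ?pnorm_ge0//.
apply: (@le_trans _ _ ((`|a| `^ p + 1) * (e / 2 / (`|a| `^ p + 1)))); last first.
  by rewrite mulrC divfK// gt_eqF.
apply: ler_pM; [exact: powR_ge0 | exact: powR_ge0 | by rewrite lerDl | exact: ltW].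
Qed.

Lemma approximable_gap_embedding z : K z -> approximable (gap_embedding z).
Proof.
move=> Kz e e0; have [x zx] := h_dense Kz e0; exists (dirac_molecule x).
by rewrite molecule_ext_dirac ?embedding_base// gap_embedding_dist.
Qed.

(** The unit vector of the coordinate [n], written through the ends of the gap so
    that it is visibly approximable. *)
Definition basis_vector n : ellp p01 := (gap_weight n)^-1 *:
  (gap_embedding (g n).2 - gap_embedding (g n).1).

Lemma approximable_basis n : approximable (basis_vector n).
Proof.
have [K1 K2 _ _] := gapP n.
have a0 : approximable 0.
  by rewrite -embedding_base; exact: approximable_gap_embedding.
have ab : approximable (gap_embedding (g n).2 - gap_embedding (g n).1).
  rewrite addrC -scaleN1r.
  by apply: approximable_linear; exact: approximable_gap_embedding.
have := approximable_linear (gap_weight n)^-1 ab a0.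
by rewrite addr0.
Qed.

(** Two gaps with a common right end overlap to the left of it. *)
Lemma gap_ends_inj m n : (g n).1 < (g m).2 <= (g n).2 -> m = n.
Proof.
move=> /andP[nm mn].
have [Km1 Km2 _ gm] := gapP m; have [Kn1 _ _ gn] := gapP n.
have b_eq : (g m).2 = (g n).2.
  apply/le_anti; rewrite mn; have [le|->//] := gn _ Km2.
  by rewrite ltNge le in nm.
pose c := Num.max (g m).1 (g n).1.
have cb : c < (g n).2 by rewrite gt_max -{1}b_eq !gap_lt.
have [cz zb] := midf_lt cb; move: cz; rewrite gt_max => /andP[mz nz].
case: g_bij => _ ginj _; apply: ginj; rewrite ?inE//.
apply: (@gap_disjoint _ _ _ _ ((c + (g n).2) / 2) (gapP m) (gapP n));
  by rewrite ?mz ?nz ?b_eq zb.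
Qed.

Lemma basis_vectorE n m : ellp_val (basis_vector n) m = (m == n)%:R.
Proof.
have [K1 K2 n12 _] := gapP n.
transitivity ((gap_weight n)^-1 * (gap_coord (g n).2 m - gap_coord (g n).1 m)).
  by rewrite -!gap_embeddingE.
rewrite (gap_coordB m (ltW n12)); have [->|mn] := eqVneq m n.
  by rewrite n12 lexx mulVf// gt_eqF// gap_weight_gt0.
by case: ifP => [/gap_ends_inj e|_]; [rewrite e eqxx in mn | rewrite mulr0].
Qed.

Lemma approximable_ellp (v : ellp p01) : approximable v.
Proof.
move=> e e0; have e2 : 0 < e / 2 by rewrite divr_gt0.
pose S_ N := \sum_(0 <= k < N) `|ellp_val v k| `^ p.
have [N hN] : exists N, pnorm v `^ p - S_ N < e / 2.
  have := @ellp_norm_cvg _ _ p01 v => /cvgrPdist_lt/(_ _ e2)[N _ hN].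
  by exists N; apply: le_lt_trans (ler_norm _) _; exact: (hN N (leqnn N)).
pose w := \sum_(0 <= k < N) ellp_val v k *: basis_vector k.
have wE m : ellp_val w m = if (m < N)%N then ellp_val v m else 0.
  rewrite /w; elim: N {hN w} => [|N IH]; first by rewrite big_nil.
  rewrite big_nat_recr//= -[LHS]/(ellp_val _ m + ellp_val v N * ellp_val (basis_vector N) m).
  rewrite IH basis_vectorE [in RHS]ltnS [in RHS]leq_eqVlt; case: eqVneq => [->|_] /=.
    by rewrite ltnn add0r mulr1.
  by rewrite mulr0 addr0.
have [mu hmu] : exists mu : molecule_space S,
    pnorm (w - molecule_ext embedding mu) `^ p < e / 2.
  suff : approximable w by exact.
  rewrite /w; elim: N {hN w wE} => [|N IH].
    rewrite big_nil -embedding_base; exact: approximable_gap_embedding.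
  rewrite big_nat_recr; last exact: leq0n.
  rewrite /= addrC.
  by apply: approximable_linear; [exact: approximable_basis | exact: IH].
exists mu; apply: le_lt_trans (pnormB_powR _ _ w) _.
rewrite [ltRHS]splitr; apply: ler_ltD; last exact: hmu.
apply/ltW; apply: le_lt_trans hN.
apply: ellp_norm_le => m.
have vwE k : ellp_val (v - w) k = ellp_val v k - ellp_val w k by [].
(* The remainder has the coordinates of [v] from [N] on. *)
have -> : \sum_(0 <= k < m) `|ellp_val (v - w) k| `^ p = S_ (maxn m N) - S_ N.
  elim: m => [|m IH]; first by rewrite big_nil max0n subrr.
  rewrite big_nat_recr// IH vwE wE /=.
  case: ltnP => mN.
    by rewrite !subrr normr0 powR0 ?gt_eqF// addr0 (maxn_idPr mN) subrr.
  by rewrite subr0 (maxn_idPl (leqW mN)) [S_ m.+1]big_nat_recr//= addrAC.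
by rewrite lerD2r; exact: ellp_partial_sum_le.
Qed.

End gap_coordinates.

(** * Free spaces over sets with null closure *)

Lemma lipschitz_free_gaps (R : realType) (p : R) (p01 : 0 < p <= 1)
    (K : set R) (K_closed : closed K) (K_null : lebesgue_measure K = 0%E)
    (g : nat -> R * R) (g_bij : set_bij [set: nat] (gaps K) g)
    (S : pointedPMetricSpace p) (h : S -> R)
    (h_isometric : forall x y, pdist x y `^ p = `|h x - h y|)
    (h_in : forall x, K (h x))
    (h_dense : forall z (e : R), K z -> 0 < e -> exists x, `|z - h x| < e) :
  isometrically_isomorphic (lipschitz_free S) (ellp p01).
Proof.
pose T := molecule_ext (embedding p01 g h).
pose TL := HB.pack_for {linear molecule_space S -> ellp p01} T
  (@GRing.isLinear.Build _ _ _ _ T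
    (molecule_ext_linear (embedding_base p01 K_closed K_null g_bij h_in))).
apply: (@completion_isometric _ _ (molecule_space S) (ellp p01) TL).
- exact: (molecule_ext_norm p01 K_closed K_null g_bij h_isometric h_in).
- exact: ellp_complete.
- move=> v e e0.
  exact: (approximable_ellp K_closed K_null g_bij h_in h_dense v e0).
Qed.

Lemma lipschitz_free_null_closure (R : realType) (p : R) (p01 : 0 < p <= 1)
    (S : pointedPMetricSpace p) (h : S -> R) :
  (forall x y, pdist x y `^ p = `|h x - h y|) -> infinite_set (range h) ->
  lebesgue_measure (closure (range h)) = 0%E ->
  isometrically_isomorphic (lipschitz_free S) (ellp p01).
Proof.
move=> h_isometric h_inf K_null; set K := closure (range h) in K_null.
have K_closed : closed K by exact: closed_closure.
have K_inf : infinite_set K.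
  by move=> Kfin; apply: h_inf; apply: sub_finite_set Kfin; exact: subset_closure.
have : ([set: nat] #= gaps K)%card.
  rewrite card_eq_sym; apply: eq_card_nat; first exact: countable_gaps.
  exact: infinite_gaps.
move=> /card_set_bijP[g g_bij].
apply: (lipschitz_free_gaps p01 K_closed K_null g_bij h_isometric).
  by move=> x; apply: subset_closure; exists x.
move=> z e Kz e0; have [_ [[x _ <-] zx]] := Kz _ (nbhsx_ballx z _ e0).
by exists x.
Qed.

(** * Ranges of monotone sequences *)

Section monotone_range.
Variable R : realType.

Lemma countable_sequence (u : nat -> R) : countable (range u).
Proof. exact: sub_countable (card_image_le u _) (countableP _). Qed.

(** A point of the closure outside of the range is an upper bound: the terms below
    any [u n] are finitely many, hence form a closed set. So it can only be the
    supremum. *)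
Lemma countable_closure_nondecreasing (u : nat -> R) : nondecreasing_seq u ->
  countable (closure (range u)).
Proof.
move=> ndu.
have ub x n : closure (range u) x -> ~ range u x -> u n <= x.
  move=> cx nx; rewrite leNgt; apply/negP => xu; apply: nx.
  have : closure (u @` `I_n `|` [set y | u n <= y]) x.
    apply: closure_subset cx => _ [m _ <-]; case: (ltnP m n) => mn.
      by left; exists m.
    by right; exact: ndu.
  rewrite closureU => -[|].
    rewrite -(closure_id _).1; first by move=> [m _ <-]; exists m.
    apply: (accessible_finite_set_closed.1 (hausdorff_accessible (@norm_hausdorff _ R))).
    by apply: finite_image; exact: finite_II.
  rewrite -(closure_id _).1; [by rewrite /= leNgt xu | exact: closed_ge].
have uniq x y : closure (range u) x -> ~ range u x ->
    closure (range u) y -> ~ range u y -> x <= y.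
  move=> cx nx cy ny; rewrite leNgt; apply/negP => yx.
  have [_ [[n _ <-] /=]] := cx _ (lt_nbhsr yx).
  by rewrite ltNge ub.
have [[x [cx nx]]|none] := pselect (exists x, closure (range u) x /\ ~ range u x).
  pose v n := if n is m.+1 then u m else x.
  apply: (@sub_countable _ _ _ (range v)); last exact: countable_sequence.
  apply/subset_card_le => y cy; have [[n _ <-]|ny] := pselect (range u y).
    by exists n.+1.
  by exists 0%N => //=; apply/le_anti; rewrite !uniq.
apply: (@sub_countable _ _ _ (range u)); last exact: countable_sequence.
by apply/subset_card_le => y cy; apply: contrapT => ny; apply: none; exists y.
Qed.

Lemma countable_closure_monotone (u : nat -> R) :
  nondecreasing_seq u \/ nonincreasing_seq u -> countable (closure (range u)).
Proof.
case=> [|niu]; first exact: countable_closure_nondecreasing.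
have ndu : nondecreasing_seq (fun n => - u n) by move=> m n mn; rewrite lerN2 niu.
apply: sub_countable (countable_closure_nondecreasing ndu).
apply: card_le_trans (card_image_le -%R _); apply/subset_card_le => x cx.
exists (- x); last exact: opprK.
move=> B /= /(@opp_continuous R^o x) /cx[_ [[n _ <-] Bn]].
by exists (- u n); split => //; exists n.
Qed.

End monotone_range.

Unset Implicit Arguments.

Theorem corollary5p5 (R : realType) (p : R) (p01 : 0 < p <= 1) :
  (forall (M : set R) (x0 : M), infinite_set M ->
     lebesgue_measure (closure M) = 0%E ->
     isometrically_isomorphic (lipschitz_free (snowflake p01 x0)) (ellp p01)) /\
  (forall u : nat -> R, nondecreasing_seq u \/ nonincreasing_seq u ->
     infinite_set (range u) -> forall x0 : range u,
     isometrically_isomorphic (lipschitz_free (snowflake p01 x0)) (ellp p01)).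
Proof.
have null_case (M : set R) (x0 : M) : infinite_set M ->
    lebesgue_measure (closure M) = 0%E ->
    isometrically_isomorphic (lipschitz_free (snowflake p01 x0)) (ellp p01).
  move=> Minf Mnull.
  have ME : range (fun x : snowflake p01 x0 => val (x : M)) = M.
    apply/seteqP; split=> [_ [x _ <-]|x Mx]; first exact: set_valP.
    by exists (exist _ x (mem_set Mx)).
  apply: (@lipschitz_free_null_closure _ _ _ _
    (fun x : snowflake p01 x0 => val (x : M))); rewrite ?ME//.
  by move=> x y; rewrite powRVK//; have /andP[] := p01.
split=> // u mono uinf x0; apply: null_case => //.
by apply: countable_lebesgue_measure0; exact: countable_closure_monotone.
Qed.
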